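(* Let $n\in\mathbb{N}$, $n\ge 1$, let $G=\mathrm{SL}(2,2^n)$, and let $C$ be a conjugacy class of $G$ such that $\operatorname{Conj}(G,C)$ is a simple quandle. Then the profile of $\operatorname{Conj}(G,C)$ is of the form $1^k\lambda^l$.
   Context: A quandle is a set $X$ with a binary operation $\triangleright$ such that (1) $x\triangleright x=x$ for all $x$; (2) for every $x\in X$ the right translation $R_x:X\to X$, $R_x(y)=y\triangleright x$, is a bijection; (3) $(x\triangleright y)\triangleright z=(x\triangleright z)\triangleright(y\triangleright z)$ for all $x,y,z$. A quandle $X$ is simple if $|X|>1$ and every quandle homomorphism from $X$ is either injective or constant. For a group $G$ and a subset $C\subseteq G$ closed under conjugation, $\operatorname{Conj}(G,C)$ is the quandle on $C$ with operation $x\triangleright y=yxy^{-1}$, so $R_x(y)=xyx^{-1}$. The profile of a finite quandle is the set of cycle types (partition types) of all right translations $R_x$, $x\in X$; for a connected quandle (one on which $\langle R_x:x\in X\rangle$ acts transitively) all $R_x$ have the same cycle type, and the profile is that common cycle type. The profile is of the form $1^k\lambda^l$ if there are an integer $\lambda>1$ and nonnegative integers $k,l$ such that every $R_x$ has exactly $k$ fixed points and $l$ cycles of length $\lambda$ and no other cycles. *)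

(* Defs.v *)
From HB Require Import structures.
From mathcomp Require Import all_boot all_order all_algebra all_fingroup.

Set Implicit Arguments.
Unset Strict Implicit.
Unset Printing Implicit Defensive.

Reserved Notation "x |> y" (at level 40, left associativity).

HB.mixin Record isQuandle X := {
  qop : X -> X -> X;
  qopxx : forall x, qop x x = x;
  qop_bij : forall x, bijective (fun y => qop y x);
  qopD : forall x y z, qop (qop x y) z = qop (qop x z) (qop y z)
}.

#[short(type="quandleType")]
HB.structure Definition Quandle := {X of isQuandle X}.

#[short(type="finQuandleType")]
HB.structure Definition FinQuandle := {X of isQuandle X & Finite X}.

Notation "x |> y" := (qop x y).

Definition quandle_hom (X Y : quandleType) (f : X -> Y) : Prop :=
  forall x y, f (x |> y) = f x |> f y.

Definition quandle_simple (X : quandleType) : Prop :=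
  (exists x y : X, x <> y) /\
  forall (Y : quandleType) (f : X -> Y), quandle_hom f ->
    injective f \/ (forall x y, f x = f y).

(* Cycle lengths in nondecreasing order, fixed points included as 1s. *)
Definition cycle_type (T : finType) (s : {perm T}) : seq nat :=
  sort leq [seq #|c| | c : {set T} <- enum (porbits s)].

Section Profile.
Variable X : finQuandleType.

Definition rtrans (x : X) : {perm X} := perm (bij_inj (qop_bij x)).

Lemma rtransE x y : rtrans x y = y |> x.
Proof. by rewrite permE. Qed.

Definition profile : seq (seq nat) := undup (codom (fun x => cycle_type (rtrans x))).

Definition profile_1k_laml : Prop :=
  exists lam k l : nat, 1 < lam /\
    forall mu, mu \in profile -> mu = nseq k 1 ++ nseq l lam.

End Profile.

Section Conj.
Local Open Scope group_scope.
Variables (gT : finGroupType) (G : {group gT}) (C : {set gT}).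

Record Conj (sCG : C \subset G) (nCG : G \subset 'N(C)) :=
  ConjElt { conj_val : gT; _ : conj_val \in C }.

Variables (sCG : C \subset G) (nCG : G \subset 'N(C)).
Local Notation Q := (Conj sCG nCG).

HB.instance Definition _ := [isSub of Q for @conj_val sCG nCG].
HB.instance Definition _ := [Equality of Q by <:].
HB.instance Definition _ := [Choice of Q by <:].
HB.instance Definition _ := [Countable of Q by <:].
HB.instance Definition _ := [Finite of Q by <:].

Lemma Conj_closed (x y : Q) : val y * val x * (val y)^-1 \in C.
Proof.
have Gy : (val y)^-1 \in G by rewrite groupV (subsetP sCG) ?(valP y).
have := memJ_norm (val x) (subsetP nCG _ Gy).
by rewrite conjgE invgK mulgA (valP x).
Qed.

Definition conj_op (x y : Q) : Q :=
  Sub (val y * val x * (val y)^-1) (Conj_closed x y).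

Lemma conj_opxx x : conj_op x x = x.
Proof. by apply: val_inj; rewrite /= mulgK. Qed.

Lemma conj_op_bij x : bijective (fun y => conj_op y x).
Proof.
apply: injF_bij => y z /(congr1 val) /= /mulIg /mulgI yz.
exact: val_inj.
Qed.

Lemma conj_opD x y z :
  conj_op (conj_op x y) z = conj_op (conj_op x z) (conj_op y z).
Proof. by apply: val_inj; rewrite /= !invMg invgK !mulgA !mulgKV. Qed.

HB.instance Definition _ := isQuandle.Build Q conj_opxx conj_op_bij conj_opD.

Lemma classes_sub : C \in classes G -> C \subset G.
Proof. by case/imsetP=> x Gx ->; apply: class_subG. Qed.

Lemma classes_norm : C \in classes G -> G \subset 'N(C).
Proof. by case/imsetP=> x _ ->; apply: class_norm. Qed.

End Conj.

Section SL2.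
Local Open Scope ring_scope.
Variable F : finFieldType.

Definition SL2 : {set {'GL_2[F]}} := [set u | \det (GLval u) == 1].

Lemma SL2_group_set : group_set SL2.
Proof.
apply/group_setP; split=> [|u v]; rewrite !inE ?GL_1E ?det1 //.
by move=> /eqP du /eqP dv; rewrite GL_ME det_mulmx du dv GRing.mulr1.
Qed.

Canonical SL2_group := Group SL2_group_set.

End SL2.

(* Main.v *)
Require Import Defs.
From mathcomp Require Import all_boot all_order all_algebra all_fingroup.
From mathcomp Require Import all_solvable all_field ring.

Set Implicit Arguments.
Unset Strict Implicit.
Unset Printing Implicit Defensive.

(** The group [SL(2, 2^n)] is a CA-group: the centraliser of every nontrivial
    element is abelian ([SL2_char2_CA]). Indeed a nonscalar 2x2 matrix [A]
    commutes only with the matrices [a A + b I], which commute with each other;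
    and a scalar matrix [a I] of determinant 1 satisfies [a^2 = 1], hence
    [a = 1] in characteristic 2, so every nontrivial element is nonscalar.

    Such a group determines the cycles of every [R_x : y |-> x y x^-1] on a
    conjugacy class ([card_porbit_rtrans]). The length of the cycle of [y] is
    the least [m > 0] such that [x^m] commutes with [y]. If [x^m] is not 1,
    then [x] and [y] both lie in the abelian centraliser of [x^m], so [y] is
    a fixed point; otherwise [m] is a multiple of the order of [x], hence equal
    to it. So all cycles have length 1 or [lambda], the order of [x].

    The multiplicities [k] and [l] do not depend on [x]: conjugation by an
    element of the group is a quandle automorphism carrying [x] to any other
    element of the class, and it conjugates the right translations
    ([cycle_type_rtransJ]). Finally, a class with two elements, such as one whose
    quandle is simple, does not contain 1, and so [lambda > 1]. *)

(** * Cycle types of permutations *)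

Section CycleType.
Local Open Scope group_scope.
Variable T : finType.
Implicit Types (s p : {perm T}) (x : T).

Lemma porbitJ s p x : porbit (s ^ p) (p x) = p @: porbit s x.
Proof.
apply/setP=> y; apply/porbitP/imsetP => [[i ->]|[z /porbitP[i ->] ->]].
  by exists ((s ^+ i) x); rewrite ?mem_porbit // -conjXg permJ.
by exists i; rewrite -conjXg permJ.
Qed.

Lemma cycle_typeJ s p : cycle_type (s ^ p) = cycle_type s.
Proof.
have pK : injective (fun c : {set T} => p @: c) by exact/imset_inj/perm_inj.
have orbJ : perm_eq (enum (porbits (s ^ p)))
                    [seq p @: c | c : {set T} <- enum (porbits s)].
  apply: uniq_perm; rewrite ?(map_inj_uniq pK) ?enum_uniq // => c.
  rewrite mem_enum; apply/imsetP/mapP => [[y _ ->]|[d]].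
    exists (porbit s (p^-1 y)); first by rewrite mem_enum imset_f.
    by rewrite -porbitJ permKV.
  by rewrite mem_enum => /imsetP[x _ ->] ->; exists (p x); rewrite ?porbitJ.
apply/perm_sortP; [exact: leq_total | exact: leq_trans | exact: anti_leq |].
rewrite (permPl (perm_map _ orbJ)) -map_comp.
by rewrite (eq_map (fun c : {set T} => card_imset c (@perm_inj _ p))).
Qed.

(** This replaces every cycle length by divisibility conditions on the
    exponents [i] for which [s ^+ i] fixes [x]. *)
Lemma card_porbit_dvdn s x i : (#|porbit s x| %| i) = ((s ^+ i) x == x).
Proof.
set m := #|porbit s x|; have m_gt0 : 0 < m by rewrite lt0n card_porbit_neq0.
have smx : (s ^+ m) x = x by rewrite permX iter_porbit.
have smkx k : (s ^+ (k * m)) x = x.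
  by elim: k => [|k IHk]; rewrite ?perm1 // mulSn expgD permM smx.
rewrite {2}(divn_eq i m) expgD permM smkx /dvdn.
have lt_im : i %% m < m by rewrite ltn_mod.
have := nth_uniq x _ _ (uniq_traject_porbit s x).
move=> /(_ (i %% m) 0); rewrite size_traject -/m => /(_ lt_im m_gt0) <-.
by rewrite !nth_traject // permX.
Qed.

Lemma cycle_type_two_lengths s lam :
    1 < lam -> (forall x, #|porbit s x| \in [:: 1%N; lam]) ->
  exists k l : nat, cycle_type s = nseq k 1%N ++ nseq l lam.
Proof.
move=> lam_gt1 cards; set cs := [seq #|c| | c : {set T} <- enum (porbits s)].
have cs_sub m : m \in cs -> m \in [:: 1%N; lam].
  by case/mapP=> c; rewrite mem_enum => /imsetP[x _ ->] ->.
pose ones := filter (pred1 1%N) cs; pose lams := filter (predC (pred1 1%N)) cs.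
have ones_nseq : ones = nseq (size ones) 1%N.
  by apply/all_pred1P; exact: filter_all.
have lams_nseq : lams = nseq (size lams) lam.
  apply/all_pred1P/allP=> m; rewrite mem_filter /= => /andP[m_neq1 /cs_sub].
  by rewrite !inE (negPf m_neq1).
exists (size ones), (size lams); rewrite -ones_nseq -lams_nseq.
apply: (sorted_eq leq_trans anti_leq); first exact: (sort_sorted leq_total).
  rewrite ones_nseq lams_nseq; elim: (size ones) => [|k IHk] /=.
    by elim: (size lams) => //= -[|l] //= ->; rewrite leqnn.
  rewrite path_min_sorted //; apply/allP=> m.
  by rewrite mem_cat !mem_nseq => /orP[] /andP[_ /eqP->] //; apply: ltnW.
by rewrite perm_sort perm_sym (perm_filterC (pred1 1%N) cs).
Qed.

End CycleType.

(** * Conjugation quandles of groups with abelian centralisers *)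

(** Right translations are defined from the operation alone, so an automorphism
    transports them by conjugation. *)
Lemma rtrans_aut (X : finQuandleType) (p : {perm X}) (x : X) :
  quandle_hom p -> rtrans (p x) = (rtrans x ^ p)%g.
Proof.
move=> hp; apply/permP=> y.
by rewrite -{2}[y](permKV p) permJ !rtransE hp permKV.
Qed.

Section ConjProfile.
Local Open Scope group_scope.
Variables (gT : finGroupType) (G : {group gT}) (C : {set gT}).
Variables (sCG : C \subset G) (nCG : G \subset 'N(C)).
Local Notation Q := (Conj sCG nCG).
Implicit Types x y : Q.

Lemma rtrans_Conj x (i : nat) y :
  val ((rtrans x ^+ i) y) = val y ^ (val x ^- i).
Proof.
elim: i => [|i IHi]; first by rewrite perm1 invg1 conjg1.
rewrite expgSr permM rtransE /= IHi expgS invMg conjgM [RHS]conjgE invgK.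
by rewrite -mulgA.
Qed.

Lemma Conj_conjg_closed g y : g \in G -> val y ^ g \in C.
Proof. by move=> Gg; rewrite memJ_norm ?(valP y) ?(subsetP nCG). Qed.

Lemma cycle_type_rtransJ x y g :
  g \in G -> val y = val x ^ g -> cycle_type (rtrans y) = cycle_type (rtrans x).
Proof.
move=> Gg yE; pose f z : Q := Sub (val z ^ g) (Conj_conjg_closed z Gg).
have f_inj : injective f.
  by move=> u v /(congr1 val)/conjg_inj/val_inj.
have f_hom : quandle_hom (perm f_inj).
  by move=> u v; apply: val_inj; rewrite !permE /= !conjMg conjVg.
have -> : y = perm f_inj x by apply: val_inj; rewrite permE /= yE.
by rewrite rtrans_aut // cycle_typeJ.
Qed.

Lemma rtrans_fixE x y i :
  ((rtrans x ^+ i) y == y) = (val y \in 'C[val x ^+ i]).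
Proof.
rewrite -val_eqE rtrans_Conj (sameP eqP conjg_fixP) (sameP commgP cent1P).
by rewrite cent1C groupV cent1C.
Qed.

(** A power [x ^+ m != 1] has an abelian centraliser; if it commutes with [y],
    then that centraliser contains both [x] and [y]. So [y] is fixed by [R_x], or
    only the trivial powers of [x] commute with [y]. *)
Lemma card_porbit_rtrans x y :
    {in G^#, forall g, abelian 'C_G[g]} ->
  #|porbit (rtrans x) y| \in [:: 1%N; #[val x]].
Proof.
move=> caG; have Gq (z : Q) : val z \in G by rewrite (subsetP sCG) ?(valP z).
have [xCy|xNCy] := boolP (val y \in 'C[val x]).
  by rewrite !inE -dvdn1 card_porbit_dvdn rtrans_fixE expg1 xCy.
rewrite !inE orbC eqn_dvd card_porbit_dvdn rtrans_fixE expg_order cent11T inE.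
(* [m] is the cycle length itself, which trivially divides [m]: this says that
   [x ^+ m] commutes with [y]. *)
have := dvdnn #|porbit (rtrans x) y|; set m := {2}#|_|.
rewrite card_porbit_dvdn rtrans_fixE order_dvdn => yCxm.
apply/orP; left; apply: contraR xNCy => xm_neq1.
have CGxm : abelian 'C_G[val x ^+ m] by apply: caG; rewrite !inE xm_neq1 groupX.
apply/cent1P; apply: (centsP CGxm); rewrite inE Gq ?yCxm //=.
by apply/cent1P/commuteX.
Qed.

Lemma Conj_profile_CA :
    C \in classes G -> C != [set 1] -> {in G^#, forall g, abelian 'C_G[g]} ->
  profile_1k_laml Q.
Proof.
case/imsetP=> c Gc CE C_neq1 caG; have Cc : c \in C by rewrite CE class_refl.
pose x : Q := Sub c Cc.
have c_neq1 : c != 1 by apply: contraNneq C_neq1 => c1; rewrite CE c1 class1G.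
have c_gt1 : 1 < #[c] by rewrite order_gt1.
have [k [l xE]] :=
  cycle_type_two_lengths c_gt1 (fun y => @card_porbit_rtrans x y caG).
exists #[c], k, l; split=> // mu; rewrite mem_undup => /codomP[y ->].
have: val y \in c ^: G by rewrite -CE (valP y).
by case/imsetP=> g Gg yE; rewrite -xE; exact: (@cycle_type_rtransJ x y g).
Qed.

End ConjProfile.

(** * Centralisers in [SL2] in characteristic 2 *)

Section SL2Char2.
Import GRing.Theory.
Local Open Scope ring_scope.
Variable F : fieldType.
Implicit Types A B X Y : 'M[F]_2.

Lemma ord2P (i : 'I_2) : i = 0 \/ i = 1.
Proof. by case: i => -[|[|//]] i2; [left | right]; apply: val_inj. Qed.

Lemma mx2P A B :
    A 0 0 = B 0 0 -> A 0 1 = B 0 1 -> A 1 0 = B 1 0 -> A 1 1 = B 1 1 ->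
  A = B.
Proof.
move=> e00 e01 e10 e11; apply/matrixP=> i j.
by case: (ord2P i) => ->; case: (ord2P j) => ->.
Qed.

Lemma mulmx2E A X i j : (A *m X) i j = A i 0 * X 0 j + A i 1 * X 1 j.
Proof.
by rewrite mxE big_ord_recl big_ord1; congr (_ + A i _ * X _ j); apply: val_inj.
Qed.

(** Commutation of [A] and [X] says that the vectors [(A01, A10, A00 - A11)] and
    [(X01, X10, X00 - X11)] are proportional: up to sign, the coordinates of
    their cross product are the entries of [A X - X A]. The first vector is
    nonzero when [A] is not scalar, so the second one is [a] times it, and then
    [X - a A] is scalar. *)
Lemma cent_nonscalar_mx2 A X :
    ~~ is_scalar_mx A -> A *m X = X *m A -> exists a b, X = a *: A + b%:M.
Proof.
move=> nsA AX.
have e i j : (A *m X) i j = (X *m A) i j by rewrite AX.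
have := e 0 0; have := e 0 1; have := e 1 0; rewrite !mulmx2E => e10 e01 e00.
suff [a [Xa01 Xa10 XaD]] : exists a, [/\ X 0 1 = a * A 0 1, X 1 0 = a * A 1 0
                                      & X 0 0 - X 1 1 = a * (A 0 0 - A 1 1)].
  exists a, (X 0 0 - a * A 0 0).
  apply: mx2P; rewrite !mxE /= ?mulr1n ?mulr0n ?addr0 //; first by ring.
  by rewrite -[X 1 1](subKr (X 0 0)) XaD; ring.
have e10' : A 1 0 * (X 0 0 - X 1 1) = X 1 0 * (A 0 0 - A 1 1).
  have -> : X 1 0 * (A 0 0 - A 1 1) =
      X 1 0 * A 0 0 + X 1 1 * A 1 0 - X 1 0 * A 1 1 - X 1 1 * A 1 0 by ring.
  by rewrite -e10; ring.
have e01' : A 0 1 * (X 0 0 - X 1 1) = X 0 1 * (A 0 0 - A 1 1).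
  have -> : X 0 1 * (A 0 0 - A 1 1) =
      A 0 0 * X 0 1 + A 0 1 * X 1 1 - A 0 1 * X 1 1 - A 1 1 * X 0 1 by ring.
  by rewrite e01; ring.
have e00' : A 0 1 * X 1 0 = X 0 1 * A 1 0.
  exact: addrI (etrans e00 (congr1 (+%R^~ _) (mulrC _ _))).
have [A01|A01] := eqVneq (A 0 1) 0; last first.
  (* In each case the ratio is read off a nonzero coordinate of [A]. *)
  exists (X 0 1 / A 0 1); rewrite divfK //; split=> //; apply: (mulfI A01).
    by rewrite e00'; field.
  by rewrite e01'; field.
have [A10|A10] := eqVneq (A 1 0) 0; last first.
  exists (X 1 0 / A 1 0); rewrite divfK //; split=> //; apply: (mulfI A10).
    by rewrite A01 !mulr0 mulrC -e00' A01 mul0r.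
  by rewrite e10'; field.
have Ad : A 0 0 - A 1 1 != 0.
  apply: contraNneq nsA => /eqP; rewrite subr_eq0 => /eqP Ad.
  apply/is_scalar_mxP; exists (A 0 0).
  by apply: mx2P; rewrite !mxE ?mulr1n ?mulr0n.
exists ((X 0 0 - X 1 1) / (A 0 0 - A 1 1)); rewrite divfK // A01 A10 !mulr0.
split=> //; apply: (mulIf Ad); rewrite mul0r.
  by rewrite -e01' A01 mul0r.
by rewrite -e10' A10 mul0r.
Qed.

Lemma cent_nonscalar_mx2_comm A X Y :
    ~~ is_scalar_mx A -> A *m X = X *m A -> A *m Y = Y *m A ->
  X *m Y = Y *m X.
Proof.
move=> nsA AX /(cent_nonscalar_mx2 nsA)[a [b ->]].
by rewrite mulmxDl mulmxDr -scalemxAl -scalemxAr AX scalar_mxC.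
Qed.

(** Here [a^2 = 1] has the single solution [a = 1] because squaring is the
    Frobenius morphism, which is injective. *)
Lemma scalar_det1_pchar2 A :
  2 \in [pchar F] -> is_scalar_mx A -> \det A = 1 -> A = 1.
Proof.
move=> F2 /is_scalar_mxP[a ->]; rewrite det_scalar => a2.
suff -> : a = 1 by [].
apply/eqP; rewrite -subr_eq0 -sqrf_eq0 -(pFrobenius_autE F2).
by rewrite rmorphB rmorph1 /= pFrobenius_autE a2 subrr.
Qed.

End SL2Char2.

Lemma SL2_char2_CA (F : finFieldType) :
    2 \in [pchar F]%R ->
  {in (SL2_group F)^#%g, forall g, abelian 'C_(SL2_group F)[g]}%g.
Proof.
move=> F2 g /setD1P[g_neq1]; rewrite inE => /eqP detg.
apply/centsP=> x /setIP[_ /cent1P xg] y /setIP[_ /cent1P yg].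
apply: val_inj; apply: (@cent_nonscalar_mx2_comm _ (GLval g)).
- apply: contra g_neq1 => nsg; apply/eqP/val_inj.
  exact: scalar_det1_pchar2 F2 nsg detg.
- exact: (congr1 GLval (esym xg)).
- exact: (congr1 GLval (esym yg)).
Qed.

Theorem theorem4p11 (n : nat) (hn : 1 <= n)
    (F : finFieldType) (hF : #|F| = 2 ^ n)
    (C : {set {'GL_2[F]}}) (hC : C \in classes (SL2_group F)) :
  quandle_simple (Conj (classes_sub hC) (classes_norm hC)) ->
  profile_1k_laml (Conj (classes_sub hC) (classes_norm hC)).
Proof.
case=> -[x [y x_neq_y]] _; apply: Conj_profile_CA => //; last first.
  exact/SL2_char2_CA/(card_finPcharP hF).
apply/eqP=> C1; apply: x_neq_y; apply: val_inj.
have C_eq1 u : u \in C -> u = 1%g by rewrite C1 => /set1P.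
by rewrite (C_eq1 _ (valP x)) (C_eq1 _ (valP y)).
Qed.
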